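(* For all $n\ge1$, $k\ge0$ and $\vec\beta\in\mathbb{N}^{l-1}$, $$Q_{n,k,\vec{\beta}}=\sum_{\pi}F_{n,\mathrm{DES}_{\geq2}(\pi)},$$ the sum being over all $\pi\in C_l\wr\mathfrak{S}_n$ with $\mathrm{inv}_{<2}(\pi)=k$ and $\vec{\mathrm{col}}(\pi)=\vec{\beta}$.
   Context: For $S\subseteq[n-1]$, $F_{n,S}=\sum x_{i_1}\cdots x_{i_n}$ over $i_1\ge\cdots\ge i_n\ge1$ with $i_j>i_{j+1}$ whenever $j\in S$. $C_l\wr\mathfrak{S}_n$ is the set of words $\pi=\pi_1\cdots\pi_n$ with $\pi_i=|\pi_i|^{\epsilon_i}$, $\epsilon_i\in\{0,\dots,l-1\}$, $|\pi_1|\cdots|\pi_n|\in\mathfrak{S}_n$; $\vec{\mathrm{col}}(\pi)=(\mathrm{col}_1(\pi),\dots,\mathrm{col}_{l-1}(\pi))$ with $\mathrm{col}_m(\pi)=|\{i:\epsilon_i=m\}|$. $\mathrm{DES}_{\ge2}(\pi)=\{i\in[n-1]:|\pi_i|>|\pi_{i+1}|\text{ and either }\epsilon_i\ne0\text{ or }|\pi_i|-|\pi_{i+1}|\ge2\}$; $\mathrm{inv}_{<2}(\pi)=|\{(i,j):i<j,\ \epsilon_i=0,\ |\pi_i|-|\pi_j|=1\}|$. For the other side: $\mathcal{B}$ is the alphabet of letters $u^m$ ($u\ge1$, $0\le m\le l-1$; $m$-colored) and barred letters $\overline{u^0}$ ($u\ge1$; $0$-colored), each with absolute value $u$ and weight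 $x_u$. A colored necklace is a primitive circular word over $\mathcal{B}$ (read clockwise, up to rotation) such that every barred letter is followed by a letter of lesser or equal absolute value, every $0$-colored unbarred letter is followed by a letter of greater or equal absolute value, and no necklace of length one is a single barred letter; a colored ornament is a finite multiset of colored necklaces with weight the product of the weights of its letters. $Q_{n,k,\vec\beta}$ is the sum of the weights of all colored ornaments with $n$ letters, exactly $k$ barred letters, and exactly $\beta_m$ $m$-colored letters for each $m\in[l-1]$ (by Hyatt's colored ornament interpretation this equals the paper's $\sum_{\pi}F_{n,\mathrm{DEX}(\pi)}$ over $\pi$ with $\mathrm{exc}(\pi)=k$, $\vec{\mathrm{col}}(\pi)=\vec\beta$). *)

(* Defs.v *)
(* Generating functions are truncated to the variables
   x_1..x_N (variable x_{i+1} is 'X_i, i : 'I_N) and live in {mpoly int[N]}. *)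
From HB Require Import structures.
From mathcomp Require Import all_boot all_algebra all_fingroup.
From mathcomp Require Import mpoly.
Set Implicit Arguments.
Unset Strict Implicit.
Unset Printing Implicit Defensive.
Import GRing.Theory.
Local Open Scope ring_scope.

(* S : pred nat is a subset of [n-1], 1-indexed: j \in S means i_j > i_{j+1}. *)
Definition fund_ok (n N : nat) (S : pred nat) (t : n.-tuple 'I_N) : bool :=
  let a := map (@nat_of_ord N) (tval t) in
  [forall j : 'I_n, (j.+1 < n)%N ==>
     ((nth 0%N a j.+1 <= nth 0%N a j)%N && (S j.+1 ==> (nth 0%N a j.+1 < nth 0%N a j)%N))].

(* F_{n,S}(x_1,...,x_N): the letter (x : 'I_N) stands for the index x+1. *)
Definition Fund (n : nat) (S : pred nat) (N : nat) : {mpoly int[N]} :=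
  \sum_(t : n.-tuple 'I_N | fund_ok S t) \prod_(x <- t) 'X_x.

(* pi = (s, e): |pi_i| = s i (shifted by one, which is harmless), eps_i = e i. *)
Definition cperm (n l : nat) := ('S_n * {ffun 'I_n -> 'I_l})%type.

Definition cabs n l (p : cperm n l) : seq nat := [seq (p.1 i : nat) | i <- enum 'I_n].
Definition ceps n l (p : cperm n l) : seq nat := [seq (p.2 i : nat) | i <- enum 'I_n].

(* DES_{>=2}(pi), as a subset of [n-1], 1-indexed *)
Definition DES2 n l (p : cperm n l) : pred nat := fun j =>
  let a := cabs p in let c := ceps p in
  [&& (0 < j)%N, (j < n)%N, (nth 0%N a j < nth 0%N a j.-1)%N &
      (nth 0%N c j.-1 != 0%N) || ((nth 0%N a j).+2 <= nth 0%N a j.-1)%N].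

Definition inv2 n l (p : cperm n l) : nat :=
  #|[set ij : 'I_n * 'I_n | [&& (ij.1 < ij.2)%N, (p.2 ij.1 : nat) == 0%N &
                               (p.1 ij.1 : nat) == (p.1 ij.2).+1]]|.

Definition colm n l (p : cperm n l) (m : nat) : nat := #|[set i | (p.2 i : nat) == m]|.

(* letter (u, m, b): absolute value u+1 (u : 'I_N), color m, barred iff b *)
Definition letter (N l : nat) := ('I_N * 'I_l * bool)%type.
Section Letters.
Variables N l : nat.
Implicit Types (x : letter N l) (w : seq (letter N l)).
Definition labs x : nat := x.1.1.
Definition lcol x : nat := x.1.2.
Definition lbar x : bool := x.2.
Definition letter_ok x : bool := lbar x ==> (lcol x == 0%N).

Definition follow_ok (ab : letter N l * letter N l) : bool :=
  let: (a, b) := ab in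
  (lbar a ==> (labs b <= labs a)%N) &&
  ((lcol a == 0%N) && ~~ lbar a ==> (labs a <= labs b)%N).

Definition primitive w : bool := all (fun k => rot k w != w) (iota 1 (size w).-1).

Fixpoint lexle (s t : seq nat) : bool :=
  match s, t with
  | [::], _ => true
  | _ :: _, [::] => false
  | x :: s', y :: t' => (x < y)%N || ((x == y) && lexle s' t')
  end.
Definition wle w1 w2 : bool := lexle (map pickle w1) (map pickle w2).

(* a necklace (class up to rotation) is represented by its lex-least rotation *)
Definition canonical_rot w : bool := all (fun k => wle w (rot k w)) (iota 0 (size w)).

Definition necklace_rep w : bool :=
  [&& (0 < size w)%N, all letter_ok w, all follow_ok (zip w (rot 1 w)),
      ~~ ((size w == 1%N) && has lbar w), primitive w & canonical_rot w].

(* cut a flat word into blocks; the boolean marks the last letter of a block *)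
Fixpoint blocks (s : seq (letter N l * bool)) (cur : seq (letter N l)) : seq (seq (letter N l)) :=
  match s with
  | [::] => if cur is [::] then [::] else [:: cur]
  | (x, e) :: s' => if e then rcons cur x :: blocks s' [::] else blocks s' (rcons cur x)
  end.
End Letters.

Definition decode N l n (t : n.-tuple (letter N l)) (e : n.-tuple bool) :=
  blocks (zip t e) [::].

(* (t, e) encodes an ornament = a multiset of necklaces, listed as a
   wle-sorted sequence of canonical representatives; t is the sequence of
   all its letters. *)
Definition ornament_code_ok N l n (t : n.-tuple (letter N l)) (e : n.-tuple bool) : bool :=
  [&& last false e, all (@necklace_rep N l) (decode t e) & sorted (@wle N l) (decode t e)].

Definition Qorn (l n k : nat) (beta : 'I_l.-1 -> nat) (N : nat) : {mpoly int[N]} :=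
  \sum_(te : n.-tuple (letter N l) * n.-tuple bool |
         [&& ornament_code_ok te.1 te.2, count (@lbar N l) te.1 == k &
             [forall j : 'I_l.-1, count (fun x => lcol x == j.+1) te.1 == beta j]])
    \prod_(x <- te.1) 'X_(x.1.1).

(* Main.v *)
(* Call a word in the letters a banner if it satisfies the necklace conditions
   on consecutive letters and its last letter is unbarred; both sides of the
   identity count banners.

   Order the letters by decreasing absolute value, barred letters first among
   those of equal absolute value. A Lyndon word for this order satisfies the
   circular necklace conditions iff it is a banner, and a nonincreasing product
   of Lyndon words is a banner iff each factor is; so the Chen-Fox-Lyndon
   factorization turns multisets of necklaces into banners.

   A pair of a colored permutation pi and a compatible word a_1 >= ... >= a_n
   is sent to the banner whose letter at v, from right to left, has absolute
   value a_{pi^-1(v)}, the color of v, and a bar iff v is 0-colored and precedes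
   v - 1 in pi. On a block of equal a's the only descents of pi are unit
   descents from 0-colored entries, so the bars determine the order of the
   block. *)
Require Import Defs.
From HB Require Import structures.
From mathcomp Require Import all_boot all_algebra all_fingroup.
From mathcomp Require Import mpoly zify.
Import GRing.Theory.
Set Implicit Arguments.
Unset Strict Implicit.
Unset Printing Implicit Defensive.
Local Open Scope nat_scope.

(** * Lyndon factorization *)

Lemma lexle_refl : reflexive lexle.
Proof. by elim=> //= x s ->; rewrite eqxx orbT. Qed.

Lemma lexle_total : total lexle.
Proof.
elim=> [|x s IH] [|y t] //=.
by case: (ltngtP x y) => //= _; apply: IH.
Qed.

Lemma lexle_anti : antisymmetric lexle.
Proof.
elim=> [|x s IH] [|y t] //=.
by case: (ltngtP x y) => //= -> /IH ->.
Qed.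

Lemma lexle_trans : transitive lexle.
Proof.
elim=> [|y t IH] [|x s] [|z r] //= xy yz //.
case/orP: xy => [ltxy|/andP[/eqP -> st]]; case/orP: yz => [ltyz|/andP[/eqP <- tr]].
- by rewrite (ltn_trans ltxy ltyz).
- by rewrite ltxy.
- by rewrite ltyz.
- by rewrite eqxx (IH _ _ st tr) orbT.
Qed.

Lemma lexle_cat2l s t1 t2 : lexle (s ++ t1) (s ++ t2) = lexle t1 t2.
Proof. by elim: s => //= x s ->; rewrite ltnn eqxx. Qed.

Lemma lexle_catr s t : lexle s (s ++ t).
Proof. by elim: s => //= x s ->; rewrite eqxx orbT. Qed.

(** A failure [~~ lexle s t] is decided at the first position where the words differ, unless [t] is
    a prefix of [s]; once this is excluded, letters appended to [t] are never reached. *)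
Lemma lexle_catl_strict s t r : ~~ lexle s t -> ~~ prefix t s -> ~~ lexle s (t ++ r).
Proof.
elim: s t => [|x s IH] [|y t] //=.
by case: (ltngtP x y) => //= _ /IH.
Qed.

Lemma cat_eq_split (T : Type) (s1 s2 t1 t2 : seq T) :
  s1 ++ s2 = t1 ++ t2 -> size s1 <= size t1 ->
  exists2 r, t1 = s1 ++ r & s2 = r ++ t2.
Proof.
elim: s1 t1 => [|x s1 IH] [|y t1] //=; try by [exists [::] | exists (y :: t1)].
by case=> -> /IH h /h [r -> ->]; exists r.
Qed.

Section Words.

Variables (T : eqType) (key : T -> nat).
Hypothesis key_inj : injective key.

Definition kle : rel (seq T) := fun u v => lexle (map key u) (map key v).
Definition kge : rel (seq T) := fun u v => kle v u.

Lemma kle_refl : reflexive kle.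
Proof. by move=> u; apply: lexle_refl. Qed.

Lemma kle_total : total kle.
Proof. by move=> u v; apply: lexle_total. Qed.

Lemma kle_anti : antisymmetric kle.
Proof. by move=> u v /lexle_anti /(inj_map key_inj). Qed.

Lemma kle_trans : transitive kle.
Proof. by move=> v u w; apply: lexle_trans. Qed.

Lemma kge_total : total kge.
Proof. by move=> u v; apply: kle_total. Qed.

Lemma kge_anti : antisymmetric kge.
Proof. by move=> u v; rewrite andbC => /kle_anti. Qed.

Lemma kge_trans : transitive kge.
Proof. by move=> v u w uv vw; apply: kle_trans vw uv. Qed.

Lemma kle_catr u v : kle u (u ++ v).
Proof. by rewrite /kle map_cat lexle_catr. Qed.

Lemma kle_cat2l u v w : kle (u ++ v) (u ++ w) = kle v w.
Proof. by rewrite /kle !map_cat lexle_cat2l. Qed.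

Lemma kle_catl_strict u v w : ~~ kle u v -> ~~ prefix v u -> ~~ kle u (v ++ w).
Proof.
move=> uv npre; rewrite /kle map_cat; apply: lexle_catl_strict => //.
by apply: contra npre; rewrite !prefixE size_map -map_take => /eqP/(inj_map key_inj) ->.
Qed.

Definition lyndon (w : seq T) : Prop :=
  w <> [::] /\
  forall u v, w = u ++ v -> u <> [::] -> v <> [::] -> ~~ kle v w.

Lemma lyndon_kle w u v : lyndon w -> w = u ++ v -> v <> [::] -> kle w v.
Proof.
case: u => [|x u] [_ lw] e v0; first by rewrite e; apply: kle_refl.
have xu0 : x :: u <> [::] by [].
by have := lw _ _ e xu0 v0; case/orP: (kle_total w v) => // ->.
Qed.

(** A suffix that starts inside a factor [f] begins with a nonempty suffix of [f], which is at least
    [f], and [f] is at least the last factor [l]. Hence the word alone determines [l]. *)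
Lemma factor_last_min fs l u v :
    {in rcons fs l, forall f, lyndon f} -> pairwise kge (rcons fs l) ->
    flatten (rcons fs l) = u ++ v -> v <> [::] ->
  kle l v.
Proof.
elim: fs u => [|f fs IH] u /= ly srt e v0.
  by apply: (@lyndon_kle _ u) => //; [apply: ly; rewrite mem_head | rewrite -e cats0].
case/andP: srt => /allP lef srt.
have lyt : {in rcons fs l, forall g, lyndon g}.
  by move=> g gin; apply: ly; rewrite inE gin orbT.
case: (leqP (size f) (size u)) => [szf|/ltnW szf].
  by have [r _ er] := cat_eq_split e szf; apply: IH er v0.
have [r ef ev] := cat_eq_split (esym e) szf.
have lf : lyndon f by apply: ly; rewrite mem_head.
have lel : kle l f by apply: lef; rewrite mem_rcons mem_head.
case: r ef ev => [|x r] ef ev; first by apply: (IH [::]).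
apply: kle_trans lel _; apply: kle_trans (lyndon_kle lf ef _) _ => //.
by rewrite ev kle_catr.
Qed.

Lemma lyndon_factorization_unique fs gs :
    {in fs, forall f, lyndon f} -> {in gs, forall f, lyndon f} ->
    pairwise kge fs -> pairwise kge gs -> flatten fs = flatten gs ->
  fs = gs.
Proof.
elim/last_ind: fs gs => [|fs f IH] gs; elim/last_ind: gs => [|gs g _] //.
- move=> _ lyg _ _; rewrite flatten_rcons /= => /esym e.
  have [] := lyg g; first by rewrite mem_rcons mem_head.
  by case: g {lyg} e; case: (flatten gs).
- move=> lyf _ _ _; rewrite flatten_rcons /= => e.
  have [] := lyf f; first by rewrite mem_rcons mem_head.
  by case: f {lyf} e; case: (flatten fs).
move=> lyf lyg srtf srtg e.
have [f0 _] : lyndon f by apply: lyf; rewrite mem_rcons mem_head.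
have [g0 _] : lyndon g by apply: lyg; rewrite mem_rcons mem_head.
have efg : f = g.
  apply: kle_anti; apply/andP; split.
    by apply: (factor_last_min lyf srtf _ g0); rewrite e flatten_rcons.
  by apply: (factor_last_min lyg srtg _ f0); rewrite -e flatten_rcons.
move: e; rewrite -efg !flatten_rcons => /eqP.
have [szfg|szfg] := eqVneq (size (flatten fs)) (size (flatten gs)); last first.
  by move/eqP/(congr1 size); rewrite !size_cat => /addIn /eqP; rewrite (negPf szfg).
rewrite eqseq_cat // => /andP[/eqP e _]; congr rcons; apply: IH => //.
- by move=> h hin; apply: lyf; rewrite mem_rcons inE hin orbT.
- by move=> h hin; apply: lyg; rewrite mem_rcons inE hin orbT.
- by move: srtf; rewrite pairwise_rcons => /andP[].
- by move: srtg; rewrite pairwise_rcons => /andP[].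
Qed.

Lemma least_suffix_exists w : w <> [::] ->
  exists u v, [/\ w = u ++ v, v <> [::] &
    forall u' v', w = u' ++ v' -> v' <> [::] -> kle v v'].
Proof.
elim: w => // x w IH _.
case: w IH => [_|y w IH].
  exists [::], [:: x]; split=> // - [|z u'] v' /=; first by move=> <- _; apply: kle_refl.
  by case=> _; case: u'; case: v'.
have [//|u [v [e v0 vmin]]] := IH.
case/orP: (kle_total v [:: x, y & w]) => le.
  exists (x :: u), v; split=> //; first by rewrite e.
  move=> [|z u'] v' /=; first by move=> <-.
  by case=> _; apply: vmin.
exists [::], [:: x, y & w]; split=> //.
move=> [|z u'] v' /=; first by move=> <- _; apply: kle_refl.
by case=> _ /vmin h /h; apply: kle_trans.
Qed.

Lemma least_suffix_lyndon w u v :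
    w = u ++ v -> v <> [::] ->
    (forall u' v', w = u' ++ v' -> v' <> [::] -> kle v v') ->
  lyndon v.
Proof.
move=> ew v0 vmin; split=> // a b ev a0 b0; apply/negP => le.
have vb : kle v b by apply: (vmin (u ++ a)) => //; rewrite -catA -ev.
have /(congr1 size) : b = v by apply: kle_anti; rewrite le vb.
by rewrite ev size_cat; case: a a0 {ev} => //= *; lia.
Qed.

Lemma lyndon_factorization_exists w : exists fs,
  [/\ {in fs, forall f, lyndon f}, pairwise kge fs & flatten fs = w].
Proof.
have [n] := ubnP (size w); elim: n w => // n IH w szw.
have [->|/eqP w0] := eqVneq w [::]; first by exists [::].
have [u [v [ew v0 vmin]]] := least_suffix_exists w0.
have ltu : size u < n.
  by move: szw; rewrite ew size_cat; case: v v0 {ew vmin} => //= *; lia.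
have lv := least_suffix_lyndon ew v0 vmin.
have [fs [lyf srt eu]] := IH u ltu.
exists (rcons fs v); split; last by rewrite flatten_rcons eu.
  by move=> f; rewrite mem_rcons inE => /orP[/eqP->|/lyf].
rewrite pairwise_rcons srt andbT.
elim/last_ind: fs => // fs m _ in lyf srt eu *.
have lm : lyndon m by apply: lyf; rewrite mem_rcons mem_head.
suff vm : kle v m.
  move: srt; rewrite pairwise_rcons all_rcons => /andP[/allP gem _].
  apply/andP; split=> //; apply/allP => f /gem mf.
  exact: kle_trans vm mf.
(* If the previous factor [m] were smaller than [v], minimality of [v] against [m ++ v] would force
   [v = m ++ r] with [r] nonempty; cancelling [m] gives [r <= v], which is impossible for a Lyndon
   word [v]. *)
apply/negPn/negP => nvm.
have vmv : kle v (m ++ v).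
  apply: (vmin (flatten fs)); first by rewrite ew -eu flatten_rcons catA.
  by case: m {lyf srt eu lm nvm}.
have [|npre] := boolP (prefix m v); last by move: (kle_catl_strict v nvm npre); rewrite vmv.
case/prefixP=> r ev; have [r0|/eqP r0] := eqVneq r [::].
  by move: nvm; rewrite ev r0 cats0 kle_refl.
have [m0 _] := lm.
case: lv => _ /(_ _ _ ev m0 r0); rewrite ev => /negP; apply.
by rewrite -(kle_cat2l m) -ev.
Qed.

(** Let [w = u ++ v] with [v <= w]. Minimality against the rotation [v ++ u] makes [v] a prefix of
    [w], so [w = v ++ u'], and primitivity gives [u' < u]. Then the rotation [u' ++ v] is smaller
    than [w]. *)
Lemma lyndon_of_rot w : w <> [::] -> (forall k, kle w (rot k w)) ->
  (forall k, 0 < k < size w -> rot k w != w) -> lyndon w.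
Proof.
move=> w0 minw prim; split=> // u v ew u0 v0; apply/negP => vw.
have szu : 0 < size u < size w.
  rewrite ew size_cat; case: u u0 {ew} => // ? ? _; case: v v0 {vw} => //= *; lia.
have erot : rot (size u) w = v ++ u by rewrite ew rot_size_cat.
have nle : ~~ kle (v ++ u) w.
  apply/negP => le; have := prim _ szu; rewrite -[_ == _]negbK => /negP; apply.
  by apply/negPn/eqP/kle_anti; rewrite minw andbT erot.
have [|npre] := boolP (prefix v w); last first.
  have nwv : ~~ kle w v.
    apply/negP => wv; move: npre; rewrite (_ : v = w) ?prefix_refl //.
    by apply: kle_anti; rewrite vw.
  by move: (kle_catl_strict u nwv npre); rewrite -erot minw.
case/prefixP=> u' ew'.
have szuu' : size u = size u'.
  by move/(congr1 size): ew'; rewrite ew !size_cat addnC => /addnI.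
have nuu' : ~~ kle u u' by rewrite -(kle_cat2l v) -ew'.
have npre : ~~ prefix u' u.
  rewrite prefixE -szuu' take_size; apply: contra nuu' => /eqP ->.
  exact: kle_refl.
have /negP[] := kle_catl_strict v nuu' npre.
apply: kle_trans (kle_catr u v) _; rewrite -ew.
by have := minw (size v); rewrite {2}ew' rot_size_cat.
Qed.

Lemma lyndon_rot w k : lyndon w -> 0 < k < size w -> kle w (rot k w) /\ rot k w != w.
Proof.
case=> w0 lw /andP[k0 kw].
have lt : ~~ kle (drop k w) w.
  apply: lw (esym (cat_take_drop k w)) _ _ => /(congr1 size).
    by rewrite size_takel ?(ltnW kw) //= => e; rewrite e in k0.
  by rewrite size_drop /=; lia.
have nle : ~~ kle (rot k w) w.
  by apply: contra lt; apply: kle_trans; apply: kle_catr.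
split; first by case/orP: (kle_total w (rot k w)) => // le; rewrite le in nle.
by apply: contra nle => /eqP ->; apply: kle_refl.
Qed.

(** * Least rotations *)

Definition minrot (w : seq T) : seq T :=
  head w (sort kle [seq rot k w | k <- iota 0 (size w)]).

Lemma minrot_spec w : (exists k, minrot w = rot k w) /\ (forall k, kle (minrot w) (rot k w)).
Proof.
have [->|w0] := eqVneq w [::].
  by split=> [|k]; [exists 0 | apply: kle_refl].
set rs := [seq rot k w | k <- iota 0 (size w)].
have srt := sort_sorted kle_total rs.
have: 0 < size (sort kle rs) by rewrite size_sort size_map size_iota; case: w w0 {rs srt}.
rewrite /minrot -/rs; case esrt: (sort kle rs) srt => [|m ms] //= srt _.
have memE r : (r \in m :: ms) = (r \in rs) by rewrite -esrt mem_sort.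
have min_rs r : r \in rs -> kle m r.
  rewrite -memE inE => /orP[/eqP-> | rin]; first exact: kle_refl.
  by have /allP := order_path_min kle_trans srt; apply.
split=> [|k].
  by have /mapP[k _ ->] : m \in rs by [rewrite -memE mem_head]; exists k.
apply: min_rs; have [kw|kw] := ltnP k (size w).
  by apply/mapP; exists k; rewrite ?mem_iota.
apply/mapP; exists 0; last by rewrite rot0 rot_oversize.
by rewrite mem_iota; case: w w0 {rs kw esrt memE}.
Qed.

Lemma rot_rot_exists (w : seq T) i j : exists k, rot i (rot j w) = rot k w.
Proof. by exists (rot_add w j i); rewrite rot_rot_add. Qed.

Lemma rot_cancel (w : seq T) k : exists j, w = rot j (rot k w).
Proof.
have /esym e : rotr k (rot k w) = w by apply: rotK.
by exists (size (rot k w) - k); rewrite {1}e.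
Qed.

Lemma minrot_rot w k : minrot (rot k w) = minrot w.
Proof.
have [[i ei] lei] := minrot_spec (rot k w); have [[j ej] lej] := minrot_spec w.
apply: kle_anti; apply/andP; split.
  rewrite ej; have [h eh] := rot_cancel w k; rewrite {2}eh.
  by have [g ->] := rot_rot_exists (rot k w) j h; apply: lei.
by rewrite ei; have [g ->] := rot_rot_exists w i k; apply: lej.
Qed.

Lemma minrot_id w : (forall k, k < size w -> kle w (rot k w)) -> minrot w = w.
Proof.
move=> minw; have [[j ej] lej] := minrot_spec w.
apply: kle_anti; apply/andP; split; first by rewrite -{2}[w]rot0.
rewrite ej; have [/minw //|jw] := ltnP j (size w).
by rewrite rot_oversize // kle_refl.
Qed.

Lemma minrot_lyndon w : lyndon w -> minrot w = w.
Proof.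
move=> lw; apply: minrot_id => - [|k] kw; first by rewrite rot0 kle_refl.
by case: (lyndon_rot lw (k := k.+1)).
Qed.

Lemma lyndon_minrot w : w <> [::] ->
  (forall k, 0 < k < size w -> rot k w != w) -> lyndon (minrot w).
Proof.
move=> w0 prim; have [[j ej] lej] := minrot_spec w; apply: lyndon_of_rot.
- by move/(congr1 size); rewrite ej size_rot; case: w w0 {prim ej lej}.
- by move=> k; rewrite {2}ej; have [g ->] := rot_rot_exists w k j; apply: lej.
move=> k; rewrite ej size_rot => /prim.
by rewrite rot_rot (inj_eq (@rot_inj _ _)).
Qed.

End Words.

(** * Ornaments and banners *)

Section Ornaments.

Variables N l : nat.
Implicit Types (x y : letter N l) (w f : seq (letter N l)) (fs bs : seq (seq (letter N l))).

Definition follow : rel (letter N l) := fun x y => follow_ok (x, y).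

Definition banner w : bool :=
  [&& all (@letter_ok N l) w, sorted follow w & ~~ last false (map (@lbar N l) w)].

Definition necklace w : bool :=
  [&& all (@letter_ok N l) w, path.cycle follow w & ~~ ((size w == 1) && has (@lbar N l) w)].

(* Larger absolute values come first and, at equal absolute value, barred
   letters come first; the summand [lcol x] only makes the key injective. *)
Definition bkey x : nat := (N - labs x) * (2 * l) + (if lbar x then lcol x else l + lcol x).

(** The second summand of [bkey] is below [2 * l], so the keys of distinct absolute values lie in
    disjoint intervals. *)
Lemma bkey_labs x y : bkey x <= bkey y -> labs y <= labs x.
Proof.
rewrite /bkey /labs /lcol /lbar; case: x y => [[u m] b] [[v m'] b'] /=.
have := ltn_ord u; have := ltn_ord v; have := ltn_ord m; have := ltn_ord m'.
by case: b; case: b'; nia.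
Qed.

Lemma bkey_inj : injective bkey.
Proof.
move=> x y e.
have eabs : labs x = labs y by apply/eqP; rewrite eqn_leq !bkey_labs ?e.
move: e; rewrite /bkey eabs => /addnI.
case: x y eabs => [[u m] b] [[v m'] b']; rewrite /labs /lcol /lbar /= => /ord_inj <-.
 have := ltn_ord m; have := ltn_ord m'.
by case: b; case: b' => hm hm' e; try lia; congr (_, _, _); apply: ord_inj; lia.
Qed.

Lemma bkey_bar x y :
  letter_ok x -> lbar x -> labs x = labs y -> bkey x <= bkey y.
Proof. by rewrite /letter_ok /bkey => + xb -> ; rewrite xb => /eqP ->; rewrite leq_add2l. Qed.

Local Notation Lyndon := (lyndon bkey).
Local Notation ge := (kge bkey).

Lemma all_follow_zip_rot w : all (@follow_ok N l) (zip w (rot 1 w)) = path.cycle follow w.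
Proof.
(* The letter that closes the cycle is generalized apart from the current first letter, which
   changes in the induction. *)
case: w => // x s; rewrite rot1_cons /path.cycle; move: (x) {2 4}x.
by elim: s => [|z s IH] y u //=; rewrite IH.
Qed.

Lemma lyndon_last_lt x s y : Lyndon (x :: rcons s y) -> bkey x < bkey y.
Proof.
case=> _ /(_ (x :: s) [:: y]) h; have {h} : ~~ kle bkey [:: y] (x :: rcons s y).
  by apply: h; rewrite ?cats1.
by rewrite /kle /=; case: (ltngtP (bkey x) (bkey y)).
Qed.

(** For length at least two, the sides differ only in the step from the last letter to the first,
    whose key is smaller. An unbarred last letter always allows this step; a barred one would force
    equal absolute values, where no key is below that of a barred letter. *)
Lemma lyndon_necklace w : Lyndon w -> necklace w = banner w.
Proof.
rewrite /necklace /banner => ly; case okw: (all _ w) => //=.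
case: w ly okw => [[]//|x s]; case/lastP: s => [_ _|s y ly okw].
  by rewrite /= orbF andbT /follow /follow_ok !leqnn !implybT.
rewrite /= size_rcons /= andbT [path _ _ (rcons (rcons _ _) _)]rcons_path.
rewrite map_rcons !last_rcons; congr (_ && _).
have ltxy := lyndon_last_lt ly.
have yx : labs y <= labs x by apply/bkey_labs/ltnW.
rewrite /follow /follow_ok yx implybT andbT; case yb: (lbar y) => //=.
apply/negbTE; apply: contraL ltxy => xy; rewrite -leqNgt; apply: bkey_bar => //.
  by move: okw; rewrite /= all_rcons => /and3P[].
by apply/eqP; rewrite eqn_leq xy yx.
Qed.

(** Let [x] begin [f] and [y] begin the next factor. The keys increase weakly from [y] to [x] to the
    end of [f], so absolute values rise weakly from the end of [f] to [y]. This suits an unbarred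
    end; the work is to exclude a barred one. *)
Lemma banner_flatten fs :
    {in fs, forall f, Lyndon f} -> pairwise ge fs ->
  banner (flatten fs) = all banner fs.
Proof.
elim: fs => [|f fs IH] //= lyf /andP[/allP gef srt].
have lyfs : {in fs, forall g, Lyndon g} by move=> g gin; apply: lyf; rewrite inE gin orbT.
rewrite -IH //.
case: fs => [|g fs] in lyf lyfs gef srt IH *; first by rewrite /= cats0 andbT.
have lf : Lyndon f by apply: lyf; rewrite mem_head.
have lg : Lyndon g by apply: lyf; rewrite inE mem_head orbT.
have gf : kle bkey g f by apply: gef; rewrite mem_head.
case: g lg gf => [[]//|y g] lg gf in lyf lyfs gef srt IH *.
have bg : banner (flatten ((y :: g) :: fs)) -> banner (y :: g).
  by rewrite IH // => /andP[].
move: bg; set r := flatten _; rewrite (_ : r = y :: (g ++ flatten fs)) //.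
move: (g ++ flatten fs) => s bg {r}.
case: f lf gf => [[]//|x f] lf gf in lyf gef *.
have yx : bkey y <= bkey x by move: gf => /orP[/ltnW|/andP[/eqP->]].
have xlast : bkey x <= bkey (last x f).
  case/lastP: f {gf lyf gef} lf => [//|f z] lf.
  by rewrite last_rcons ltnW // (lyndon_last_lt lf).
have labs1 : labs (last x f) <= labs x by apply: bkey_labs.
have labs2 : labs x <= labs y by apply: bkey_labs.
apply/idP/andP => [/and3P[]|[/and3P[okf srtf endf] /and3P[oks srts ends]]]; last first.
  apply/and3P; split; first by rewrite all_cat okf.
    rewrite /= cat_path; move: srtf srts => /= -> ->; rewrite andbT /follow /follow_ok.
    move: endf; rewrite /= last_map => /negPf -> /=.
    by rewrite (leq_trans labs1) ?implybT.
  by rewrite map_cat last_cat.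
rewrite all_cat => /andP[okf oks]; rewrite /= cat_path /= => /and3P[srtf fol srts].
rewrite map_cat last_cat => ends.
have bans : banner (y :: s) by apply/and3P.
split=> //; apply/and3P; split=> //; rewrite /= last_map; apply/negP => barf.
have labs3 : labs y <= labs (last x f) by move: fol; rewrite /follow /follow_ok barf => /andP[].
have okl : letter_ok (last x f) by move/allP: okf; apply; rewrite mem_last.
have lastx : bkey (last x f) <= bkey y.
  by apply: bkey_bar => //; apply/eqP; rewrite eqn_leq labs3 (leq_trans labs1).
(* All three keys now agree, and a Lyndon word of length at least two ends on a larger key than it
   starts with. *)
have f0 : f = [::].
  move: lf lastx yx; clear; case/lastP: f => // f z lf.
  by rewrite last_rcons; have := lyndon_last_lt lf; lia.
(* Being at most a one-letter word with the same first letter, [y :: g] is that single barred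
   letter, which is not a banner. *)
move: gf; rewrite f0 in barf lastx *.
have exy : x = y by apply: bkey_inj; apply/eqP; rewrite eqn_leq yx lastx.
rewrite exy /kle /= ltnn eqxx /=; case: (g) (bg bans) => // /and3P[_ _].
by rewrite /= -exy barf.
Qed.

Lemma necklace_rot k w : necklace (rot k w) = necklace w.
Proof. by rewrite /necklace rot_cycle size_rot has_rot (perm_all _ (permEl (perm_rot k w))). Qed.

Lemma primitiveP w :
  reflect (forall k, 0 < k < size w -> rot k w != w) (primitive w).
Proof.
apply: (iffP allP) => prim k; last by rewrite mem_iota => ?; apply: prim; lia.
by move=> ?; apply: prim; rewrite mem_iota; lia.
Qed.

(** * Lyndon and canonical rotations of a necklace *)

Local Notation lyn := (minrot bkey).
Local Notation pk := (@pickle (letter N l)).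
Local Notation canon := (minrot pk).

Lemma pk_inj : injective pk.
Proof. exact: pcan_inj pickleK. Qed.

Lemma necklace_repE w :
  necklace_rep w = [&& w != [::], necklace w, primitive w & canonical_rot w].
Proof.
rewrite /necklace_rep /necklace all_follow_zip_rot lt0n size_eq0.
by case: (w != _) => //=; rewrite -!andbA.
Qed.

Lemma necklace_rep_neq0 w : necklace_rep w -> w != [::].
Proof. by rewrite necklace_repE => /and4P[]. Qed.

Lemma lyndon_rep w : necklace_rep w -> Lyndon (lyn w).
Proof.
rewrite necklace_repE => /and4P[/eqP w0 _ /primitiveP prim _].
exact: (lyndon_minrot bkey_inj).
Qed.

Lemma banner_rep w : necklace_rep w -> banner (lyn w).
Proof.
move=> nw; rewrite -(lyndon_necklace (lyndon_rep nw)).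
have [[k ->] _] := minrot_spec bkey w.
by move: nw; rewrite necklace_rot necklace_repE => /and4P[].
Qed.

Lemma canon_lyn w : necklace_rep w -> canon (lyn w) = w.
Proof.
rewrite necklace_repE => /and4P[_ _ _ /allP cw].
have [[k ->] _] := minrot_spec bkey w.
rewrite (minrot_rot pk_inj); apply: (minrot_id pk_inj) => j jw.
by apply: (cw j); rewrite mem_iota.
Qed.

Lemma lyn_canon f : Lyndon f -> lyn (canon f) = f.
Proof.
move=> lf; have [[k ->] _] := minrot_spec pk f.
by rewrite (minrot_rot bkey_inj) (minrot_lyndon bkey_inj).
Qed.

Lemma necklace_rep_canon f : Lyndon f -> banner f -> necklace_rep (canon f).
Proof.
move=> lf bf; rewrite necklace_repE.
have [[k ek] lek] := minrot_spec pk f; apply/and4P; split.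
- by case: lf => /eqP; rewrite -!size_eq0 ek size_rot.
- by rewrite ek necklace_rot lyndon_necklace.
- apply/primitiveP => j; rewrite ek size_rot rot_rot (inj_eq (@rot_inj _ _)).
  by move=> /(lyndon_rot lf)[].
apply/allP => j _; change (kle pk (canon f) (rot j (canon f))).
by rewrite {2}ek; have [i ->] := rot_rot_exists f j k.
Qed.

(** * Flat codes of lists of blocks *)

Definition marks bs : seq bool :=
  flatten [seq rcons (nseq (size b).-1 false) true | b <- bs].

Lemma blocks_cons b x t e cur :
  blocks (zip (rcons b x ++ t) (rcons (nseq (size b) false) true ++ e)) cur =
  rcons (cur ++ b) x :: blocks (zip t e) [::].
Proof. by elim: b cur => [|y b IH] cur /=; rewrite ?cats0 // IH cat_rcons. Qed.

Lemma blocks_flatten bs :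
  all (fun b => b != [::]) bs -> blocks (zip (flatten bs) (marks bs)) [::] = bs.
Proof.
elim: bs => //= b bs IH /andP[b0 /IH {}IH]; case/lastP: b b0 => // b x _.
by rewrite /marks /= size_rcons /= blocks_cons IH.
Qed.

(** The hypothesis on [last] says that no block is left unfinished. The letters of [cur] have been
    read without an end mark, whence the leading [false] values. *)
Lemma flatten_blocks t e cur :
    size t = size e -> last (cur == [::]) e ->
  flatten (blocks (zip t e) cur) = cur ++ t /\
  marks (blocks (zip t e) cur) = nseq (size cur) false ++ e.
Proof.
elim: t e cur => [|x t IH] [|b e] cur //=; first by move=> _ /eqP ->.
case: b => -[sz] le.
  have [/= -> e2] := IH e [::] sz le; rewrite cat_rcons; split=> //.
  by rewrite /marks /= -/(marks _) e2 size_rcons /= cat_rcons.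
have lc : last (rcons cur x == [::]) e by case: (cur).
have [-> ->] := IH e _ sz lc; rewrite cat_rcons size_rcons; split=> //.
by rewrite -(addn1 (size cur)) nseqD -catA.
Qed.

Lemma last_marks bs : bs != [::] -> last false (marks bs).
Proof.
case/lastP: bs => // bs b _.
by rewrite /marks map_rcons flatten_rcons last_cat last_rcons.
Qed.

Lemma size_marks bs : all (fun b => b != [::]) bs -> size (marks bs) = size (flatten bs).
Proof.
elim: bs => //= b bs IH /andP[b0 /IH {}IH].
rewrite /marks /= !size_cat -/(marks _) IH size_rcons size_nseq.
by case: b b0.
Qed.

Lemma perm_flatten_minrot (key : letter N l -> nat) bs :
  perm_eq (flatten (map (minrot key) bs)) (flatten bs).
Proof.
elim: bs => //= b bs IH; apply: perm_cat => //.
by have [[k ->] _] := minrot_spec key b; rewrite perm_rot.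
Qed.

Definition ornament_factors n (te : n.-tuple (letter N l) * n.-tuple bool) :=
  sort ge (map lyn (decode te.1 te.2)).

Section Code.

Variables (n : nat) (te : n.-tuple (letter N l) * n.-tuple bool).
Hypothesis ok_te : ornament_code_ok te.1 te.2.

Lemma decodeK : flatten (decode te.1 te.2) = te.1 /\ marks (decode te.1 te.2) = te.2.
Proof.
case/and3P: ok_te => le _ _.
have sz : size te.1 = size te.2 by rewrite !size_tuple.
have le' : last ([::] == [::] :> seq (letter N l)) te.2.
  by move: le; case: (tval te.2).
by have [] := flatten_blocks sz le'.
Qed.

Lemma ornament_factorsP :
  [/\ {in ornament_factors te, forall f, Lyndon f}, pairwise ge (ornament_factors te),
      all banner (ornament_factors te) &
      perm_eq (flatten (ornament_factors te)) te.1].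
Proof.
case/and3P: ok_te => _ /allP reps _; split.
- by move=> f; rewrite mem_sort => /mapP[b /reps nb ->]; apply: lyndon_rep.
- rewrite -(sorted_pairwise (@kge_trans _ bkey)).
  by apply: sort_sorted; apply: kge_total.
- by apply/allP => f; rewrite mem_sort => /mapP[b /reps nb ->]; apply: banner_rep.
have [e _] := decodeK; rewrite -[X in perm_eq _ X]e.
apply: perm_trans (perm_flatten_minrot bkey _).
by apply: perm_flatten; rewrite perm_sort.
Qed.

Lemma perm_canon_factors : perm_eq (map canon (ornament_factors te)) (decode te.1 te.2).
Proof.
case/and3P: ok_te => _ /allP reps _.
have -> : decode te.1 te.2 = map canon (map lyn (decode te.1 te.2)).
  rewrite -map_comp -[LHS]map_id; apply/eq_in_map => b /reps nb /=.
  by rewrite canon_lyn.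
by rewrite /ornament_factors; apply: perm_map; rewrite perm_sort.
Qed.

End Code.

(** Uniqueness of the factorization returns the factors, their canonical rotations return the blocks
    up to order, and sorting by [wle] fixes the order. *)
Lemma ornament_factors_inj n (te te' : n.-tuple (letter N l) * n.-tuple bool) :
    ornament_code_ok te.1 te.2 -> ornament_code_ok te'.1 te'.2 ->
    flatten (ornament_factors te) = flatten (ornament_factors te') ->
  te = te'.
Proof.
move=> ok ok' e.
have [ly srt _ _] := ornament_factorsP ok; have [ly' srt' _ _] := ornament_factorsP ok'.
have {}e := lyndon_factorization_unique bkey_inj ly ly' srt srt' e.
have eb : decode te.1 te.2 = decode te'.1 te'.2.
  have [/and3P[_ _ s] /and3P[_ _ s']] := (ok, ok').
  apply: (sorted_eq (@kle_trans _ pk) (kle_anti pk_inj) s s').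
  rewrite -(permPl (perm_canon_factors ok)) e.
  by apply: perm_canon_factors.
have [[t1 m1] [t2 m2]] := (decodeK ok, decodeK ok').
case: te te' {ok ok' e ly ly' srt srt'} t1 m1 t2 m2 eb => [t e] [t' e'] /= t1 m1 t2 m2 eb.
by congr (_, _); apply: val_inj; rewrite /= -?t1 -?t2 -?m1 -?m2 eb.
Qed.

Lemma ornament_factors_onto n (w : n.-tuple (letter N l)) :
    0 < n -> banner w ->
  exists2 te : n.-tuple (letter N l) * n.-tuple bool,
    ornament_code_ok te.1 te.2 & flatten (ornament_factors te) = w.
Proof.
move=> n0 bw; have [fs [ly srt ew]] := lyndon_factorization_exists bkey_inj w.
have /allP bfs : all banner fs by rewrite -banner_flatten // ew.
pose bs := sort (@wle N l) (map canon fs).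
have perm_bs : perm_eq bs (map canon fs) by rewrite perm_sort.
have reps : all (@necklace_rep N l) bs.
  apply/allP => b; rewrite mem_sort => /mapP[f fin ->].
  by apply: necklace_rep_canon; [apply: ly | apply: bfs].
have bs0 : all (fun b => b != [::]) bs by apply: sub_all reps; apply: necklace_rep_neq0.
have szt : size (flatten bs) == n.
  rewrite (perm_size (perm_flatten perm_bs)) (perm_size (perm_flatten_minrot _ _)) ew.
  by rewrite size_tuple.
have sze : size (marks bs) == n by rewrite size_marks.
have dec : decode (Tuple szt) (Tuple sze) = bs by apply: blocks_flatten.
exists (Tuple szt, Tuple sze).
  apply/and3P; split; rewrite ?dec //.
    (* An empty code fails the test on its last mark; here [0 < n] enters. *)
    by apply: last_marks; apply: contraL n0 => /eqP bsn; rewrite -(eqP szt) bsn.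
  by apply: sort_sorted; apply: kle_total.
rewrite -ew; congr flatten; rewrite /ornament_factors dec.
have srt' : sorted ge fs by rewrite (sorted_pairwise (@kge_trans _ bkey)).
apply: (sorted_eq (@kge_trans _ bkey) (kge_anti bkey_inj) _ srt').
  by apply: sort_sorted; apply: kge_total.
rewrite perm_sort; apply: perm_trans (perm_map lyn perm_bs) _.
rewrite -map_comp (_ : map _ fs = fs) // -[RHS]map_id.
by apply/eq_in_map => f fin; apply/lyn_canon/ly.
Qed.

End Ornaments.

(** * From ornament codes to a sum over banners *)

Lemma sum_transport (V : nmodType) (I J : finType) (P : pred I) (Q : pred J) (h : I -> J)
    (F : I -> V) (G : J -> V) :
    {in P &, injective h} -> (forall i, P i -> Q (h i)) ->
    (forall j, Q j -> exists2 i, P i & h i = j) -> (forall i, P i -> F i = G (h i)) ->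
  (\sum_(i | P i) F i = \sum_(j | Q j) G j)%R.
Proof.
move=> injh hQ hsurj FG; rewrite (eq_bigr _ FG) -(big_imset (h := h) (A := P)) //.
apply: eq_bigl => j; apply/imsetP/idP => [[i Pi ->]|/hsurj[i Pi <-]]; first exact: hQ.
by exists i.
Qed.

Definition wstat N l k (beta : 'I_l.-1 -> nat) (w : seq (letter N l)) : bool :=
  (count (@lbar N l) w == k) &&
  [forall j : 'I_l.-1, count (fun x => lcol x == j.+1) w == beta j].

Lemma Qorn_banner (l n k : nat) (beta : 'I_l.-1 -> nat) (N : nat) : 0 < n ->
  (Qorn n k beta N =
   \sum_(w : n.-tuple (letter N l) | banner w && wstat k beta w) \prod_(x <- w) 'X_(x.1.1))%R.
Proof.
move=> n0; rewrite /Qorn.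
(* The default [te.1] only serves invalid codes; on valid ones the sizes agree. *)
pose h (te : n.-tuple (letter N l) * n.-tuple bool) :=
  insubd te.1 (flatten (ornament_factors te)).
have val_h te : ornament_code_ok te.1 te.2 -> h te = flatten (ornament_factors te) :> seq _.
  move=> ok; rewrite val_insubd; have [_ _ _ /perm_size ->] := ornament_factorsP ok.
  by rewrite size_tuple eqxx.
have perm_h te : ornament_code_ok te.1 te.2 -> perm_eq te.1 (h te).
  by move=> ok; rewrite val_h // perm_sym; have [] := ornament_factorsP ok.
have wstat_h te : ornament_code_ok te.1 te.2 -> wstat k beta te.1 = wstat k beta (h te).
  move/perm_h/seq.permP => cnt; rewrite /wstat cnt; congr (_ && _).
  by apply: eq_forallb => j; rewrite cnt.
apply: (sum_transport (h := h)).
- move=> te te' /andP[ok _] /andP[ok' _] e.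
  by apply: ornament_factors_inj => //; rewrite -!val_h // e.
- move=> te /andP[ok]; rewrite -/(wstat _ _ _) wstat_h // => ->; rewrite andbT val_h //.
  by have [ly srt ban _] := ornament_factorsP ok; rewrite banner_flatten.
- move=> w /andP[bw st]; have [te ok e] := ornament_factors_onto n0 bw.
  have ehw : h te = w by apply: val_inj; rewrite /= val_h.
  by exists te => //; apply/andP; split=> //; rewrite -/(wstat _ _ _) wstat_h // ehw.
by move=> te /andP[ok _]; apply/perm_big/perm_h.
Qed.

(** * Banners and colored permutations *)

Section ChainStart.

Variable chained : nat -> bool.

(** The least [u] such that every value above [u] and up to [v] is chained. *)
Fixpoint chain_start (v : nat) : nat :=
  if v is v'.+1 then if chained v then chain_start v' else v else 0.

Lemma chain_start_le v : chain_start v <= v.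
Proof. by elim: v => //= v IH; case: ifP => // _; apply: leqW. Qed.

Lemma chain_start_mono u v : u <= v -> chain_start u <= chain_start v.
Proof.
elim: v => [|v IH]; first by rewrite leqn0 => /eqP ->.
rewrite leq_eqVlt => /orP[/eqP -> //|/IH] le /=; case: ifP => // _.
by apply: leq_trans le (leq_trans (chain_start_le v) _).
Qed.

Lemma chain_startP u v : u <= v ->
  (chain_start u = chain_start v <-> forall w, u < w <= v -> chained w).
Proof.
elim: v => [|v IH].
  by rewrite leqn0 => /eqP ->; split=> // _ w; case: w.
rewrite leq_eqVlt => /orP[/eqP -> |le]; first by split=> // _ w; lia.
have {IH}[IH1 IH2] := IH le; rewrite /=; case: ifP => chv.
  split=> [/IH1 ch w /andP[uw]|ch]; last by apply: IH2 => w ?; apply: ch; lia.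
  by rewrite leq_eqVlt => /orP[/eqP ->|wv] //; apply: ch; rewrite uw.
split=> [e|ch]; first by have := chain_start_le u; lia.
by move: chv; rewrite ch //; lia.
Qed.

End ChainStart.

(** An initial stretch of unit descents occupies every value between its ends. A later rise that
    still stays below [x 0] would land on one of them, against injectivity. *)
Lemma unit_descents (x : nat -> nat) m :
    (forall i j, i <= m -> j <= m -> x i = x j -> i = j) ->
    (forall i, i < m -> x i < x i.+1 \/ x i = (x i.+1).+1) ->
    x m < x 0 ->
  forall i, i <= m -> x i + i = x 0.
Proof.
elim: m => [|m IH] inj step lt; first by rewrite ltnn in lt.
have inj' i j : i <= m -> j <= m -> x i = x j -> i = j.
  by move=> im jm; apply: inj; lia.
have step' i : i < m -> x i < x i.+1 \/ x i = (x i.+1).+1 by move=> im; apply: step; lia.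
have [m0|m0] := eqVneq m 0.
  move=> [|[|i]]; rewrite ?addn0 // m0 // => _.
  by rewrite m0 in lt step; case: (step 0 isT); lia.
(* A step falls by at most one, so [x m.+1 < x 0] bounds [x m] by [x 0], and injectivity makes the
   bound strict. *)
have ne : x m <> x 0 by move=> e; have := inj m 0; lia.
have ltm : x m < x 0 by have := step m (ltnSn m); lia.
have {IH}desc := IH inj' step' ltm.
have down : x m = (x m.+1).+1.
  (* After a rise, the value [x m.+1] would already be taken at index [x 0 - x m.+1]. *)
  case: (step m (ltnSn m)) => // up; exfalso.
  have k := desc m (leqnn m).
  have ik : x 0 - x m.+1 <= m by lia.
  have := desc _ ik; have := inj (x 0 - x m.+1) m.+1.
  lia.
move=> i; rewrite leq_eqVlt => /orP[/eqP -> |]; last exact: desc.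
by have := desc m (leqnn m); lia.
Qed.

Section WordsToPermutations.

Variables (n N l : nat).
Implicit Types (L : 'I_n -> letter N l) (u v w i j : 'I_n).

(* [L v] is the letter of a banner read from the right: it is followed by
   [L u] when [v = u.+1], and [L 0] is the last letter. *)
Definition bannerL L : Prop :=
  [/\ forall v, letter_ok (L v),
      forall u v, v = u.+1 :> nat -> follow (L v) (L u) &
      forall v, v = 0 :> nat -> ~~ lbar (L v)].

(** A predicate on [nat], as [chain_start] requires. A linked value [k] comes directly before
    [k - 1] in the order [prec], and 0 is never linked. *)
Definition linked L (k : nat) : bool :=
  [exists v : 'I_n, exists u : 'I_n,
    [&& v == k :> nat, v == u.+1 :> nat, lbar (L v) & labs (L v) == labs (L u)]].

Lemma linkedP L u v : v = u.+1 :> nat ->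
  linked L v = lbar (L v) && (labs (L v) == labs (L u)).
Proof.
move=> e; apply/existsP/idP => [[v' /existsP[u' /and4P[/eqP ev /eqP eu b s]]]|/andP[b s]].
  have -> : v = v' by apply: ord_inj.
  have -> : u = u' by apply: ord_inj; lia.
  by rewrite b.
by exists v; apply/existsP; exists u; rewrite e !eqxx b s.
Qed.

(* The order in which the values [v] occur in the permutation encoded by [L]:
   by decreasing letter, and among equal letters by increasing chains of
   barred letters, each chain being listed downwards. *)
Definition prec L u v : bool :=
  let g := chain_start (linked L) in
  (labs (L v) < labs (L u)) ||
  (labs (L u) == labs (L v)) && ((g u < g v) || (g u == g v) && (v < u)).

Lemma prec_irr L v : prec L v v = false.
Proof. by rewrite /prec !ltnn !eqxx. Qed.

Lemma prec_trans L u v w : prec L u v -> prec L v w -> prec L u w.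
Proof. rewrite /prec; lia. Qed.

Lemma prec_total L u v : u != v -> prec L u v || prec L v u.
Proof. by rewrite -val_eqE /prec /=; lia. Qed.

Lemma prec_asym L u v : prec L u v -> prec L v u -> False.
Proof. by move=> uv /(prec_trans uv); rewrite prec_irr. Qed.

Definition barb (p : cperm n l) v : bool :=
  let q := (p.1^-1)%g in
  (p.2 (q v) == 0 :> nat) && [exists u : 'I_n, (v == u.+1 :> nat) && (q v < q u)].

Lemma barbP (p : cperm n l) u v : v = u.+1 :> nat ->
  barb p v = (p.2 ((p.1^-1)%g v) == 0 :> nat) && ((p.1^-1)%g v < (p.1^-1)%g u).
Proof.
move=> e; rewrite /barb; congr (_ && _); apply/existsP/idP => [[u' /andP[/eqP e' lt]]|lt].
  by have -> : u = u' by apply: ord_inj; lia.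
by exists u; rewrite e eqxx.
Qed.

Definition letters (pt : cperm n l * n.-tuple 'I_N) v : letter N l :=
  let q := (pt.1.1^-1)%g in (tnth pt.2 (q v), pt.1.2 (q v), barb pt.1 v).

Lemma fund_okP (p : cperm n l) (t : n.-tuple 'I_N) :
  reflect (forall i j, j = i.+1 :> nat ->
     tnth t j <= tnth t i /\
     (p.1 j < p.1 i -> (p.2 i != 0 :> nat) || ((p.1 j).+2 <= p.1 i) -> tnth t j < tnth t i))
    (fund_ok (DES2 p) t).
Proof.
have nth_t i : nth 0 (map (@nat_of_ord N) t) i = tnth t i.
  by rewrite (nth_map (tnth t i)) ?size_tuple // -tnth_nth.
have nth_abs i : nth 0 (cabs p) i = p.1 i.
  by rewrite (nth_map i) ?size_enum_ord // nth_ord_enum.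
have nth_eps i : nth 0 (ceps p) i = p.2 i.
  by rewrite (nth_map i) ?size_enum_ord // nth_ord_enum.
apply: (iffP forallP) => [ok i j e|ok i].
  have jn := ltn_ord j; have := ok i; rewrite -e jn /= !nth_t => /andP[le des].
  split=> // lt cond; move: des; rewrite /DES2 e /= -e jn !nth_abs nth_eps lt /=.
  by rewrite cond.
apply/implyP => jn; pose j := Ordinal jn.
have [//|le des] := ok i j; apply/andP.
rewrite -[i.+1]/(nat_of_ord j) !nth_t; split=> //; apply/implyP => /and4P[_ _].
rewrite [j.-1]/(nat_of_ord i) nth_eps !nth_abs; exact: des.
Qed.

(** * From colored permutations to banners *)

Section FromPermutation.

Variables (p : cperm n l) (t : n.-tuple 'I_N).
Hypothesis ok : fund_ok (DES2 p) t.
Let q := (p.1^-1)%g.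
Let L := letters (p, t).

Let pq v : p.1 (q v) = v. Proof. by rewrite /q permKV. Qed.
Let qp i : q (p.1 i) = i. Proof. by rewrite /q permK. Qed.

Lemma fund_mono i j : i <= j -> tnth t j <= tnth t i.
Proof.
case: j => j jn; elim: j jn => [|j IH] jn /=.
  by rewrite leqn0 => /eqP e; rewrite (_ : i = Ordinal jn) //; apply: ord_inj.
rewrite leq_eqVlt => /orP[/eqP e|lt].
  by rewrite (_ : i = Ordinal jn) //; apply: ord_inj.
apply: leq_trans (IH (ltnW jn) lt).
by have /fund_okP/(_ (Ordinal (ltnW jn)) (Ordinal jn) (erefl _))[] := ok.
Qed.

(* Within a block of equal letters the only descents are unit descents from
   uncolored entries, so reaching [u] after a larger [v] forces the entries
   in between to be [v, v - 1, ..., u]. *)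
Lemma linked_between u v (k : nat) :
  u < v -> q v < q u -> labs (L u) = labs (L v) -> u < k <= v -> linked L k.
Proof.
move=> uv ltq; rewrite /L /labs /= -/q => eb /andP[uk kv].
have /fund_okP okP := ok.
(* [pos d] is the position [d] places after that of [v]; the default [q v] is not met up to the
   position of [u]. *)
pose pos (d : nat) : 'I_n := insubd (q v) (q v + d).
have posE d : d <= q u - q v -> pos d = q v + d :> nat.
  by move=> dle; rewrite val_insubd; case: ifP => //; have := ltn_ord (q u); lia.
have tpos d : d <= q u - q v -> tnth t (pos d) = tnth t (q v) :> nat.
  move=> dle; apply/eqP; rewrite eqn_leq -{2}eb !fund_mono //; rewrite posE //; lia.
have step d : d < q u - q v -> p.1 (pos d) < p.1 (pos d.+1) \/
    (p.1 (pos d) = (p.1 (pos d.+1)).+1 :> nat /\ p.2 (pos d) = 0 :> nat).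
  move=> dlt; have [] := okP (pos d) (pos d.+1).
    by rewrite !posE //; lia.
  move=> _; rewrite !tpos ?ltnn //; last exact: ltnW.
  have : p.1 (pos d) != p.1 (pos d.+1) :> nat.
    apply/eqP => /ord_inj/perm_inj/(congr1 (@nat_of_ord n)); rewrite !posE //; lia.
  case: (p.2 (pos d) =P 0 :> nat) => /=; lia.
have pos0 : pos 0 = q v by apply: ord_inj; rewrite posE ?addn0.
have posm : pos (q u - q v) = q u by apply: ord_inj; rewrite posE //; lia.
have desc : forall d, d <= q u - q v -> p.1 (pos d) + d = p.1 (pos 0) :> nat.
  apply: (@unit_descents (fun d => p.1 (pos d) : nat)).
  - move=> i j im jm /ord_inj/perm_inj/(congr1 (@nat_of_ord n)); rewrite !posE //; lia.
  - by move=> i /step; lia.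
  by rewrite pos0 posm !pq.
have := desc _ (leqnn _); rewrite pos0 posm !pq => euv.
(* The stretch from [v] to [u] is a run of unit descents, so [k] stands [v - k] places after [v],
   and [k - 1] right behind it. *)
have dlt : v - k < q u - q v by lia.
have dle : v - k <= q u - q v by lia.
have e1 := desc _ dle; have e2 := desc _ dlt; rewrite pos0 pq in e1 e2.
have kE : k = p.1 (pos (v - k)) :> nat by lia.
have kS : p.1 (pos (v - k)) = (p.1 (pos (v - k).+1)).+1 :> nat by lia.
rewrite {1}kE (linkedP L kS) /L /lbar /labs /= (barbP p kS) -/q !qp !tpos // eqxx andbT.
rewrite !posE //; case: (step _ dlt) => [|[_ ->]]; first by rewrite kS; lia.
by rewrite eqxx; lia.
Qed.

(** Each linked value is barred, hence precedes the value one below it; this chains from [v] down to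
    [u]. *)
Lemma linked_pos u v :
  (forall k : nat, u < k <= v -> linked L k) -> u < v -> q v < q u.
Proof.
case: v => v vn; elim: v vn => [|v IH] vn //= lk uv.
have vS : Ordinal vn = (Ordinal (ltnW vn)).+1 :> nat by [].
have := lk v.+1; rewrite uv leqnn => /(_ isT).
rewrite -[v.+1]/(nat_of_ord (Ordinal vn)) (linkedP L vS) => /andP[].
rewrite {1}/L /lbar /= (barbP p vS) -/q => /andP[_ lt] _.
move: uv; rewrite ltnS leq_eqVlt => /orP[/eqP e|uv].
  by rewrite (_ : u = Ordinal (ltnW vn)) //; apply: ord_inj.
apply: ltn_trans lt _; apply: IH => // j /= hj; apply: lk => /=; lia.
Qed.

(** Only equal absolute values need care. If [u < v] had the same chain start, the values above [u]
    up to [v] would be linked and [v] would come first. If [v < u], both lie on one chain by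
    [linked_between]. *)
Lemma prec_of_pos u v : q u < q v -> prec L u v.
Proof.
move=> ltq; have := fund_mono (ltnW ltq).
rewrite leq_eqVlt => /orP[/eqP eb|lt]; last by apply/orP; left.
apply/orP; right; apply/andP; split; first by rewrite /labs /= -/q eb.
have ebL : labs (L u) = labs (L v) by rewrite /labs /= -/q eb.
case: (ltngtP u v) => [uv|vu|/ord_inj e]; last by rewrite e ltnn in ltq.
  rewrite andbF orbF ltn_neqAle chain_start_mono ?andbT 1?ltnW //.
  apply/eqP => e; have [lk _] := chain_startP (linked L) (ltnW uv).
  by have := linked_pos (lk e) uv; lia.
rewrite andbT; apply/orP; right; apply/eqP/esym.
apply/(chain_startP (linked L) (ltnW vu)) => k ?; exact: (linked_between (u := v) (v := u)).
Qed.

(** Positions order the values totally and [prec] is asymmetric, so one implication suffices. *)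
Lemma prec_letters u v : prec L u v = (q u < q v).
Proof.
apply/idP/idP => [uv|]; last exact: prec_of_pos.
case: (ltngtP (q u) (q v)) => // [/prec_of_pos vu|/ord_inj/perm_inj e].
  by case: (prec_asym uv vu).
by rewrite e prec_irr in uv.
Qed.

Lemma letters_banner : bannerL L.
Proof.
split=> [v|u v e|v e].
- by rewrite /letter_ok /lbar /lcol /= /barb; apply/implyP => /andP[].
- rewrite /follow /follow_ok /lbar /lcol /labs /= (barbP p e) -/q.
  case: (p.2 (q v) =P 0 :> nat) => //= _.
  by case: (ltngtP (q v) (q u)) => /= h; rewrite ?andbT; apply: fund_mono; rewrite ?h // ltnW.
rewrite /lbar /= /barb; apply/negP => /andP[_ /existsP[u /andP[/eqP]]].
by rewrite e.
Qed.

End FromPermutation.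

Lemma card_ord_lt (k : nat) : k <= n -> #|[set i : 'I_n | i < k]| = k.
Proof.
move=> kn; rewrite -sum1_card; under eq_bigl do rewrite inE.
by rewrite -(big_ord_widen n (fun=> 1) kn) sum1_card card_ord.
Qed.

Lemma perm_rank (q : 'S_n) v : #|[set u | q u < q v]| = q v.
Proof.
rewrite -[RHS](card_ord_lt (ltnW (ltn_ord (q v)))).
rewrite -(card_imset [set u | q u < q v] (@perm_inj _ q)).
apply: eq_card => i; rewrite inE; apply/imsetP/idP => [[u]|lt]; first by rewrite inE => lt ->.
by exists ((q^-1)%g i); rewrite ?inE permKV.
Qed.

(** The order [prec] is computed from the letters alone and gives the positions of all values; the
    compatible word and the colors are then read off. *)
Lemma letters_inj (pt pt' : cperm n l * n.-tuple 'I_N) :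
    fund_ok (DES2 pt.1) pt.2 -> fund_ok (DES2 pt'.1) pt'.2 ->
  letters pt =1 letters pt' -> pt = pt'.
Proof.
case: pt pt' => [[s c] t] [[s' c'] t'] /= ok ok' e.
have precE u v : prec (letters ((s, c), t)) u v = prec (letters ((s', c'), t')) u v.
  rewrite /prec !e; suff g k : chain_start (linked (letters ((s, c), t))) k =
      chain_start (linked (letters ((s', c'), t'))) k by rewrite !g.
  elim: k => //= k ->; congr (if _ then _ else _).
  by apply: eq_existsb => v'; apply: eq_existsb => u'; rewrite !e.
have eq_q v : (s^-1)%g v = (s'^-1)%g v.
  apply: ord_inj; rewrite -perm_rank -[RHS]perm_rank; apply: eq_card => u.
  by rewrite !inE -(prec_letters ok) -(prec_letters ok') precE.
have es : s = s' by apply: invg_inj; apply/permP.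
subst s'; have e' i : (tnth t i, c i) = (tnth t' i, c' i).
  by have := e (s i); rewrite /letters /= !permK => -[-> -> _].
congr (_, _, _); first by apply/ffunP => i; case: (e' i).
by apply: eq_from_tnth => i; case: (e' i).
Qed.

(** * From banners to colored permutations *)

Section ToPermutation.

Variable L : 'I_n -> letter N l.
Hypothesis banL : bannerL L.

Definition rank v : nat := #|[set u | prec L u v]|.

Lemma rank_lt v : rank v < n.
Proof.
rewrite -[X in _ < X](card_ord n) -cardsT; apply: proper_card.
by rewrite properT; apply/eqP => /setP/(_ v); rewrite !inE prec_irr.
Qed.

Lemma rank_mono u v : prec L u v -> rank u < rank v.
Proof.
move=> uv; apply: proper_card; apply/properP; split.
  by apply/subsetP => w; rewrite !inE => /prec_trans; apply.
by exists u; rewrite !inE ?prec_irr.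
Qed.

Lemma rank_prec u v : rank u < rank v -> prec L u v.
Proof.
move=> lt; have [e|/(prec_total L)/orP[//|/rank_mono]] := eqVneq u v; last by lia.
by rewrite e ltnn in lt.
Qed.

Definition rank_ord v : 'I_n := Ordinal (rank_lt v).

Lemma rank_ord_inj : injective rank_ord.
Proof.
move=> u v /(congr1 (@nat_of_ord n)) /= e; apply/eqP/negPn/negP.
by move/(prec_total L)/orP => -[] /rank_mono; rewrite e ltnn.
Qed.

Let q : 'S_n := perm rank_ord_inj.
Let p : cperm n l := ((q^-1)%g, [ffun i => (L ((q^-1)%g i)).1.2]).
Let t : n.-tuple 'I_N := [tuple (L ((q^-1)%g i)).1.1 | i < n].

Let qE v : q v = rank v :> nat. Proof. by rewrite permE. Qed.

(** For a 0-colored [v > 0] with absolute value different from that of [v - 1], the follow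
    conditions decide which comes first. For equal ones, a barred [v] continues the chain of [v - 1]
    and precedes it, while an unbarred [v] starts a later chain. *)
Lemma barb_rank v : barb p v = lbar (L v).
Proof.
have [okL folL endL] := banL.
case: (posnP v) => [v0|v0].
  rewrite (negPf (endL v v0)); apply/negP => /andP[_ /existsP[u /andP[/eqP]]].
  by rewrite v0.
have un : v.-1 < n by apply: leq_ltn_trans (leq_pred v) (ltn_ord v).
pose u := Ordinal un; have e : v = u.+1 :> nat by rewrite /= prednK.
rewrite (barbP p e) /= invgK ffunE permK.
have := okL v; have := folL u v e; rewrite /follow /follow_ok /letter_ok.
rewrite -/(lcol (L v)).
have gu := chain_start_le (linked L) u.
have gv : chain_start (linked L) v =
    if lbar (L v) && (labs (L v) == labs (L u)) then chain_start (linked L) u else v.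
  by rewrite -(linkedP L e) e.
have -> : (q v < q u) = prec L v u.
  by rewrite !qE; apply/idP/idP => [/rank_prec|/rank_mono].
rewrite /prec gv; move: (chain_start _ u) gu => g gu.
case: (lbar (L v)) => /= [|]; case: (lcol (L v) =P 0) => //= _.
  by case: eqP => [->|]; rewrite ?ltnn ?eqxx /= => h; lia.
by move=> h _; lia.
Qed.

Lemma letters_rank : letters (p, t) =1 L.
Proof.
move=> v; rewrite /letters /= barb_rank /= invgK ffunE tnth_mktuple permK.
by case: (L v) => [[]].
Qed.

Lemma fund_ok_rank : fund_ok (DES2 p) t.
Proof.
have [okL _ _] := banL.
apply/fund_okP => i j e; rewrite /p /t /= !tnth_mktuple ffunE.
set u := (q^-1)%g i; set v := (q^-1)%g j.
have ru : rank u = i by rewrite -qE permKV.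
have rv : rank v = j by rewrite -qE permKV.
have puv : prec L u v by apply: rank_prec; rewrite ru rv e.
rewrite -/(labs (L u)) -/(labs (L v)) -/(lcol (L u)).
split=> [|vu cond]; first by move: puv; rewrite /prec; lia.
(* Without a strict decrease, the descent from [u] to [v] stays on one chain, so [u] is barred and
   0-colored and [v + 2 <= u]. Then [w = u - 1] lies strictly between them in [prec], although their
   ranks are consecutive. *)
rewrite ltnNge; apply/negP => le.
have eb : labs (L u) = labs (L v) by move: puv; rewrite /prec; lia.
have eg : chain_start (linked L) v = chain_start (linked L) u.
  have := chain_start_mono (linked L) (ltnW vu).
  by move: puv; rewrite /prec eb ltnn eqxx /=; lia.
have /(chain_startP (linked L) (ltnW vu)) lk := eg.
have wn : u.-1 < n by apply: leq_ltn_trans (leq_pred u) (ltn_ord u).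
pose w := Ordinal wn; have ew : u = w.+1 :> nat by rewrite /= prednK //; lia.
have : linked L u by apply: lk; rewrite vu leqnn.
rewrite (linkedP L ew) => /andP[bu /eqP ebw].
have cu : lcol (L u) == 0 by have := okL u; rewrite /letter_ok bu.
move: cond; rewrite cu /= => v2u.
have vw : v < w by lia.
have gw : chain_start (linked L) w = chain_start (linked L) u.
  by apply/chain_startP => [|k ?]; [lia | apply: lk; lia].
have /rank_mono : prec L u w by rewrite /prec -ebw gw ltnn !eqxx ltnn /= ew.
have /rank_mono : prec L w v by rewrite /prec -eb -ebw gw eg ltnn !eqxx ltnn.
by rewrite ru rv e; lia.
Qed.

Lemma letters_onto : exists2 pt, fund_ok (DES2 pt.1) pt.2 & letters pt =1 L.
Proof. by exists (p, t); [apply: fund_ok_rank | apply: letters_rank]. Qed.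

End ToPermutation.

(** A pair counted by [inv2] is determined by the value of its first entry. *)
Lemma inv2_barb (p : cperm n l) : inv2 p = #|[set v | barb p v]|.
Proof.
rewrite /inv2; set S := [set ij : 'I_n * 'I_n | _].
have injf : {in S &, injective (fun ij : 'I_n * 'I_n => p.1 ij.1)}.
  move=> [i j] [i' j']; rewrite !inE /= => /and3P[_ _ /eqP e] /and3P[_ _ /eqP e'] ee.
  rewrite (perm_inj ee); congr (_, _); apply: (@perm_inj _ p.1); apply: ord_inj.
  by move: e'; rewrite -ee e => -[].
rewrite -(card_in_imset injf); apply: eq_card => v; rewrite inE.
apply/imsetP/idP => [[[i j]] /[!inE] /= /and3P[ij c0 /eqP e] ->|].
  by rewrite (barbP p e) !permK c0.
case/andP=> c0 /existsP[u /andP[/eqP e lt]].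
exists ((p.1^-1)%g v, (p.1^-1)%g u); rewrite /= ?permKV // inE /= !permKV.
by rewrite lt c0 e eqxx.
Qed.

Definition wordL L : n.-tuple (letter N l) := [tuple L (rev_ord i) | i < n].

Lemma big_wordL (V : Type) (idx : V) (op : Monoid.com_law idx) L
    (P : pred (letter N l)) (F : letter N l -> V) :
  \big[op/idx]_(x <- wordL L | P x) F x = \big[op/idx]_(v | P (L v)) F (L v).
Proof.
rewrite big_tuple [RHS](reindex_inj rev_ord_inj).
by apply: eq_big => i; rewrite tnth_mktuple.
Qed.

Lemma count_wordL L (P : pred (letter N l)) : count P (wordL L) = #|[set v | P (L v)]|.
Proof. by rewrite -sum1_count big_wordL -sum1_card; apply: eq_bigl => v; rewrite inE. Qed.

Lemma banner_wordL L : reflect (bannerL L) (banner (wordL L)).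
Proof.
have wordE i x : nth x (wordL L) i = L (rev_ord i) by rewrite -tnth_nth tnth_mktuple.
have lastE : last false (map (@lbar N l) (wordL L)) = nth false (map (@lbar N l) (wordL L)) n.-1.
  by rewrite -nth_last size_map size_tuple.
have nth_bar i : nth false (map (@lbar N l) (wordL L)) i = lbar (L (rev_ord i)).
  by rewrite (nth_map (L i)) ?size_tuple // wordE.
apply: (iffP and3P) => [[/allP okw srt nbar]|[okL folL endL]].
  split=> [v|u v e|v v0].
  - by apply: okw; rewrite -[v]rev_ordK -(tnth_mktuple (fun i => L (rev_ord i))) mem_tnth.
  - have vn := ltn_ord v; have un := ltn_ord u.
    move/(sortedP (L u)): srt => /(_ (rev_ord v)).
    rewrite size_tuple wordE rev_ordK => h.
    have eS : (rev_ord v).+1 = rev_ord u :> nat by rewrite /=; lia.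
    by move: h; rewrite eS wordE rev_ordK; apply; apply: ltn_ord.
  move: nbar; rewrite lastE; have -> : n.-1 = rev_ord v by rewrite /= v0 subn1.
  by rewrite nth_bar rev_ordK.
split.
- by apply/allP => x /tnthP[i ->]; rewrite tnth_mktuple.
- case: (posnP n) => [n0|n0]; first by case: (wordL L) => -[|? ?] //=; rewrite n0.
  apply/(sortedP (L (Ordinal n0))) => i; rewrite size_tuple => iS.
  have i0 := ltnW iS.
  rewrite -[i.+1]/(nat_of_ord (Ordinal iS)) wordE -[i]/(nat_of_ord (Ordinal i0)) wordE.
  by apply: folL => /=; lia.
case: (posnP n) => [n0|n0]; first by case: (wordL L) => -[|? ?] //=; rewrite n0.
have mn : n.-1 < n by rewrite prednK.
rewrite lastE -[n.-1]/(nat_of_ord (Ordinal mn)) nth_bar; apply: endL => /=; lia.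
Qed.

End WordsToPermutations.

Lemma colm_letters n N l (pt : cperm n l * n.-tuple 'I_N) m :
  colm pt.1 m = count (fun x => lcol x == m) (wordL (letters pt)).
Proof.
rewrite count_wordL -(card_imset _ (@perm_inj _ (pt.1.1^-1)%g)); apply: eq_card => i.
rewrite inE; apply/idP/imsetP => [ci|[v] /[!inE] cv -> //].
by exists (pt.1.1 i); rewrite ?inE /lcol /= permK.
Qed.

Local Open Scope ring_scope.

Theorem theorem5p1 (l n k : nat) (beta : 'I_l.-1 -> nat) :
  (0 < l)%N -> (1 <= n)%N ->
  forall N : nat,
    Qorn n k beta N =
    \sum_(p : cperm n l | (inv2 p == k) && [forall j : 'I_l.-1, colm p j.+1 == beta j])
      Fund n (DES2 p) N.
Proof.
(* Each [Fund] is expanded, so the right side becomes a sum over pairs of a colored permutation and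
   a compatible word. *)
move=> _ n0 N; rewrite Qorn_banner // [RHS]pair_big_dep /=; symmetry.
pose h (pt : cperm n l * n.-tuple 'I_N) := wordL (letters pt).
have stat pt : wstat k beta (h pt) =
    (inv2 pt.1 == k) && [forall j : 'I_l.-1, colm pt.1 j.+1 == beta j].
  rewrite /wstat count_wordL inv2_barb; congr (_ && _).
  by apply: eq_forallb => j; rewrite colm_letters.
apply: (sum_transport (h := h)).
- move=> pt pt' /andP[_ ok] /andP[_ ok'] e; apply: letters_inj => // v.
  by have /(congr1 (fun w => tnth w (rev_ord v))) := e; rewrite !tnth_mktuple rev_ordK.
- move=> [p t] /andP[st ok]; rewrite stat st andbT.
  by apply/banner_wordL/letters_banner.
- move=> w /andP[bw st]; pose L v := tnth w (rev_ord v).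
  have eL : wordL L = w by apply: eq_from_tnth => i; rewrite tnth_mktuple /L rev_ordK.
  have /banner_wordL banL : banner (wordL L) by rewrite eL.
  have [pt ok e] := letters_onto banL.
  have ew : h pt = w by rewrite -eL; apply: eq_from_tnth => i; rewrite !tnth_mktuple e.
  by exists pt; rewrite // -stat ew st.
(* The banner lists its letters by value and the compatible word by position; reindexing along the
   inverse permutation matches the weights. *)
move=> pt _; rewrite big_wordL big_tuple.
by rewrite [LHS](reindex_inj (@perm_inj _ (pt.1.1^-1)%g)).
Qed.
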